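(* Let $\{G_n(x)\}_{n\ge0}$ be a generalized Fibonacci polynomial sequence (GFP). Let $a,b,c,d,t$ be nonnegative integers with $\min\{a,b,c,d\}-t\ge 0$ and $a+b=c+d$. Then $$\begin{vmatrix} G_a(x) & G_c(x)\\ G_d(x) & G_b(x)\end{vmatrix}=(-1)^t g^t(x)\begin{vmatrix} G_{a-t}(x) & G_{c-t}(x)\\ G_{d-t}(x) & G_{b-t}(x)\end{vmatrix}.$$
   Context: A generalized Fibonacci polynomial sequence (GFP) is a sequence in $\mathbb{Z}[x]$ given by $G_0(x)=p_0(x)$, $G_1(x)=p_1(x)$, $G_n(x)=d(x)G_{n-1}(x)+g(x)G_{n-2}(x)$ for $n\ge 2$, where $p_0(x)$ is a constant and $p_1(x),d(x),g(x)$ are non-zero polynomials in $\mathbb{Z}[x]$ with $\gcd(d(x),g(x))=1$. Standing assumption when $p_0\ne 0$: $\gcd(p_0(x),p_1(x))=\gcd(p_0(x),d(x))=\gcd(p_0(x),g(x))=1$. (The integer $d$ used as an index is unrelated to the polynomial $d(x)$.) Vertical bars denote the determinant. *)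

(* Defs.v *)
From HB Require Import structures.
From mathcomp Require Import all_boot all_order all_algebra.

Set Implicit Arguments.
Unset Strict Implicit.
Unset Printing Implicit Defensive.

Import Order.TTheory GRing.Theory Num.Theory.
Local Open Scope ring_scope.

(* gcd(p, q) = 1 in the factorial ring Z[x]: the only common divisors are the
   units.  This is not [coprimep], whose pseudo-division ignores nonzero integer
   factors and therefore amounts to coprimality in Q[x]: [coprimep 2 (2 * 'X)]
   holds although 2 is a common divisor in Z[x]. *)
Definition gcd1 (p q : {poly int}) : Prop :=
  forall h : {poly int},
    (exists u, p = h * u) -> (exists v, q = h * v) -> h \is a GRing.unit.

Record is_GFP (p0 : int) (p1 d g : {poly int}) (G : nat -> {poly int}) : Prop :=
  IsGFP {
    GFP_init0 : G 0%N = p0%:P;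
    GFP_init1 : G 1%N = p1;
    GFP_rec : forall n : nat, (2 <= n)%N ->
      G n = d * G (n - 1)%N + g * G (n - 2)%N;
    GFP_p1_neq0 : p1 != 0;
    GFP_d_neq0 : d != 0;
    GFP_g_neq0 : g != 0;
    GFP_gcd_dg : gcd1 d g;
    GFP_gcd_p0 : p0 != 0 ->
      [/\ gcd1 p0%:P p1, gcd1 p0%:P d & gcd1 p0%:P g]
  }.

Definition mx22 (R : Type) (a11 a12 a21 a22 : R) : 'M[R]_2 :=
  \matrix_(i < 2, j < 2)
    if i == ord0 then (if j == ord0 then a11 else a12)
    else (if j == ord0 then a21 else a22).

(* Main.v *)
Require Import Defs.
From HB Require Import structures.
From mathcomp Require Import all_boot all_order all_algebra.
From mathcomp Require Import ring.

Set Implicit Arguments.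
Unset Strict Implicit.
Unset Printing Implicit Defensive.

Import Order.TTheory GRing.Theory Num.Theory.
Local Open Scope ring_scope.

(** The identity holds for every solution [G] of a second-order linear
    recurrence [G_(n+2) = d G_(n+1) + g G_n] over a commutative ring, whatever
    the initial values.  The key is that [G_(m+1) G_(n+1) + g G_m G_n] depends
    on [m + n] only ([recurrence_pairing_sum]).  Equating its values at [(a, b)]
    and [(c, d)] when [a + b = c + d], and moving the terms in [g] to the other
    side, says that raising all four indices by one multiplies
    [G_a G_b - G_c G_d] by [- g] ([recurrence_minor_succ]); iterating [t] times
    gives the theorem. *)

Section LinearRecurrence.

Variables (R : comNzRingType) (d g : R) (G : nat -> R).
Hypothesis G_rec : forall n, G n.+2 = d * G n.+1 + g * G n.

(** Expanding the higher index on either side by the recurrence gives the same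
    expression
    [d G_(m+1) G_(n+1) + g (G_m G_(n+1) + G_(m+1) G_n)], which is symmetric in
    [m] and [n]. *)
Lemma recurrence_pairing_shift m n :
  G m.+2 * G n.+1 + g * (G m.+1 * G n) = G m.+1 * G n.+2 + g * (G m * G n.+1).
Proof. by rewrite !G_rec; ring. Qed.

Lemma recurrence_pairing_sum m n :
  G m.+1 * G n.+1 + g * (G m * G n) = G 1%N * G (m + n).+1 + g * (G 0%N * G (m + n)%N).
Proof.
elim: m n => [//|m IHm] n.
by rewrite recurrence_pairing_shift IHm addnS addSn.
Qed.

Lemma recurrence_minor_succ i j k l : (i + j = k + l)%N ->
  G i.+1 * G j.+1 - G k.+1 * G l.+1 = - g * (G i * G j - G k * G l).
Proof.
move=> eq_sum.
have eq_pairing : G i.+1 * G j.+1 + g * (G i * G j) =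
                  G k.+1 * G l.+1 + g * (G k * G l).
  by rewrite (recurrence_pairing_sum i) (recurrence_pairing_sum k) eq_sum.
by rewrite -[G i.+1 * _](addrK (g * (G i * G j))) eq_pairing; ring.
Qed.

Lemma recurrence_minor_addn t i j k l : (i + j = k + l)%N ->
  G (i + t)%N * G (j + t)%N - G (k + t)%N * G (l + t)%N =
  (- g) ^+ t * (G i * G j - G k * G l).
Proof.
move=> eq_sum; elim: t => [|t IHt]; first by rewrite !addn0 mul1r.
rewrite !addnS recurrence_minor_succ ?IHt ?exprS ?mulrA //.
by rewrite addnACA eq_sum addnACA.
Qed.

End LinearRecurrence.

Lemma det_mx22 (R : comNzRingType) (x y z w : R) :
  \det (mx22 x y z w) = x * w - y * z.
Proof.
rewrite (expand_det_row _ ord0) big_ord_recl big_ord1 /cofactor !det_mx11 !mxE /=.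
by rewrite expr0 expr1 mul1r mulN1r mulrN.
Qed.

Theorem theorem12 (p0 : int) (p1 dx gx : {poly int}) (G : nat -> {poly int})
    (hG : is_GFP p0 p1 dx gx G) (a b c d t : nat)
    (ht : (t <= minn (minn a b) (minn c d))%N) (habcd : (a + b = c + d)%N) :
  \det (mx22 (G a) (G c)
             (G d) (G b)) =
  (-1) ^+ t * gx ^+ t *
  \det (mx22 (G (a - t)%N) (G (c - t)%N)
             (G (d - t)%N) (G (b - t)%N)).
Proof.
have G_rec n : G n.+2 = dx * G n.+1 + gx * G n.
  by rewrite (GFP_rec hG) // subn1 subn2.
move: ht; rewrite !leq_min => /andP[/andP[le_ta le_tb] /andP[le_tc le_td]].
have eq_sum : (a - t + (b - t) = c - t + (d - t))%N.
  apply: (@addIn (t + t)); rewrite addnACA (addnACA (c - t)%N).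
  by rewrite !subnK.
rewrite !det_mx22 -exprMn mulN1r -(recurrence_minor_addn G_rec t eq_sum).
by rewrite !subnK.
Qed.
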